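(* Let $k\in\mathbb{N}$. For $r\in\mathbb{N}_0$ we have $$\mathbb{E}R_k^{r}=\mathbb{E}\prod_{p\in\mathcal{P}}p^{-rZ_k(p)}=\prod_{p\in\mathcal{P}}\frac{\left(1-\frac1p\right)^{k}}{\left(1-\frac1{p^{r+1}}\right)^{k}}\sum_{j=1}^{k}\binom kj(-1)^{j-1}\frac{1-\frac{1}{p^{j(r+1)}}}{1-\frac{1}{p^{(j-1)(r+1)+1}}}.$$ In particular, $\mathbb{E}R_1^{r}=1$, as well as $$C_{r,2}=\mathbb{E}R_2^{r}=\frac{\zeta(r+2)}{\zeta(2)},$$ $$C_{r,3}=\mathbb{E}R_3^{r}=\zeta(r+2)\zeta(2r+3)\prod_{p\in\mathcal{P}}\left(1-\frac1p\right)^2\left(1+\frac2p+\frac{2}{p^{r+2}}+\frac{1}{p^{r+3}}\right).$$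
   Context: $\mathbb{N}=\{1,2,3,\ldots\}$, $\mathbb{N}_0=\mathbb{N}\cup\{0\}$, $\mathcal{P}$ is the set of prime numbers, and $\zeta(s)=\sum_{n\ge1}n^{-s}=\prod_{p\in\mathcal{P}}(1-p^{-s})^{-1}$ for $\operatorname{Re}s>1$ is the Riemann zeta function. $(\mathcal{G}_j(p))_{1\le j\le k,\,p\in\mathcal{P}}$ is a family of mutually independent random variables with $\mathbb{P}\{\mathcal{G}_j(p)=i\}=\left(1-\frac1p\right)\frac1{p^{i}}$ for $i\in\mathbb{N}_0$. Put $$Z_k(p)=\sum_{j=1}^{k}\mathcal{G}_j(p)-\max_{1\le j\le k}\mathcal{G}_j(p),\qquad R_k=\prod_{p\in\mathcal{P}}p^{-Z_k(p)}.$$ The constants $C_{r,k}$ are defined by $$C_{r,k}=\prod_{p\in\mathcal{P}}\left(1-\frac1p\right)^{k}\sum_{\ell_1,\ldots,\ell_k=0}^{\infty}\frac{p^{r\max(\ell_1,\ldots,\ell_k)}}{p^{(r+1)(\ell_1+\cdots+\ell_k)}}.$$ *)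

(* Defs.v *)
From HB Require Import structures.
From mathcomp Require Import all_boot all_order all_algebra finmap.
From mathcomp Require Import all_classical all_reals all_analysis.

Set Implicit Arguments.
Unset Strict Implicit.
Unset Printing Implicit Defensive.

Import Order.TTheory GRing.Theory Num.Theory.
Import numFieldNormedType.Exports.

Local Open Scope classical_set_scope.
Local Open Scope ring_scope.

(* The primes are taken in increasing order. Since [limn] is total, results
   about a [prime_prod] are accompanied by [prime_prod_cvg]. *)
Definition prime_partial_prod (R : realType) (f : nat -> R) : R ^nat :=
  fun n => \prod_(0 <= p < n | prime p) f p.

Definition prime_prod (R : realType) (f : nat -> R) : R :=
  limn (prime_partial_prod f).

Definition prime_prod_cvg (R : realType) (f : nat -> R) : Prop :=
  cvgn (prime_partial_prod f).

(* [riemannR s] is the sequence n |-> 1 / (n + 1) `^ s; only real s > 1 is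
   meaningful. *)
Definition zeta (R : realType) (s : R) : R := limn (series (riemannR s)).

Definition independent_RVs d (T : measurableType d) (R : realType)
    (P : probability T R) d' (T' : measurableType d') (I : choiceType)
    (D : set I) (X : I -> {RV P >-> T'}) : Prop :=
  forall (J : {fset I}) (B : I -> set T'),
    [set` J] `<=` D -> (forall i, measurable (B i)) ->
    P (\bigcap_(i in [set` J]) (X i @^-1` B i)) =
    (\prod_(i <- J) P (X i @^-1` B i))%E.

(* The family is indexed by all of nat, but only the G j p with p prime are
   constrained. *)
Definition geometric_family d (T : measurableType d) (R : realType)
    (P : probability T R) (k : nat) (G : 'I_k -> nat -> {RV P >-> nat}) : Prop :=
  independent_RVs [set jp : 'I_k * nat | prime jp.2]
    (fun jp => G jp.1 jp.2) /\
  forall (j : 'I_k) (p i : nat), prime p ->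
    P (G j p @^-1` [set i]) = ((1 - p%:R^-1) * p%:R ^- i)%:E.

Section randomZ.
Context d (T : measurableType d) (R : realType) (P : probability T R).
Context (k : nat) (G : 'I_k -> nat -> {RV P >-> nat}).

(* The truncated subtraction is exact: a maximum of naturals is at most
   their sum. *)
Definition Zk (p : nat) (w : T) : nat :=
  (\sum_(j < k) G j p w - \max_(j < k) G j p w)%N.

(* All factors at primes lie in ]0, 1], so this product converges for every
   w. *)
Definition Rk (w : T) : R := prime_prod (fun p => p%:R ^- Zk p w).

End randomZ.

Section constantC.
Context (R : realType) (r k : nat).

Definition C_term (p : nat) (l : {ffun 'I_k -> nat}) : R :=
  p%:R ^+ (r * \max_(j < k) l j) / p%:R ^+ (r.+1 * \sum_(j < k) l j).

Definition C_factor (p : nat) : R :=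
  (1 - p%:R^-1) ^+ k *
  fine (\esum_(l in [set: {ffun 'I_k -> nat}]) (C_term p l)%:E).

Definition constC : R := prime_prod C_factor.

Definition C_well_defined : Prop :=
  (forall p, prime p ->
     summable [set: {ffun 'I_k -> nat}] (fun l => (C_term p l)%:E)) /\
  prime_prod_cvg C_factor.

End constantC.

(* Main.v *)
(* Write q = 1/p and x = q^(r+1). By independence over the primes and dominated
   convergence, the r-th moment of R_k is the product over p of
   E p^(-r Z_k(p)), which is the p-th factor of C_{r,k}. That factor is computed
   by summing over the level sets of the maximum m: the tuples with all entries
   below m contribute ((1 - x^m)/(1 - x))^k, and expanding the difference of two
   consecutive such terms by the binomial theorem leaves k geometric series.
   For k = 2, 3 the factor simplifies to a rational function of q and x, and the
   zeta values come from Euler's sieve: if S_n is the sum of m^(-s) over the m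
   without prime factor below n, then S_0 = zeta(s), S_{n+1} = (1 - n^(-s)) S_n for n prime, and
   S_n tends to 1. *)
Require Import Defs.
From HB Require Import structures.
From mathcomp Require Import all_boot all_order all_algebra finmap.
From mathcomp Require Import all_classical all_reals all_analysis.
From mathcomp Require Import measurable_realfun ring lra.

Set Implicit Arguments.
Unset Strict Implicit.
Unset Printing Implicit Defensive.

Import Order.TTheory GRing.Theory Num.Theory.
Import numFieldNormedType.Exports.

Local Open Scope classical_set_scope.
Local Open Scope ring_scope.

(** * Sums over countable types and the Euler product *)

(** Linearity and the exchange with the integral are used for series over [nat], so sums are
    transported along [pickle]; an index that codes no element contributes 0. *)
Lemma esum_countE (R : realType) (I : countType) (a : I -> \bar R) :
  (forall i, 0 <= a i)%E ->
  (\esum_(i in [set: I]) a i = \sum_(n <oo) oapp a 0 (pickle_inv n))%E.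
Proof.
move=> a0.
have a'0 n : (0 <= oapp a 0 (@pickle_inv I n))%E by case: pickle_inv => //=.
rewrite nneseries_esumT//.
have -> : (\esum_(i in [set: I]) a i =
           \esum_(i in [set: I]) oapp a 0 (@pickle_inv I (choice.pickle i)))%E.
  by apply: eq_esum => i _; rewrite pickleK_inv.
rewrite -(@esum_image _ _ _ setT choice.pickle
  (fun n => oapp a 0 (@pickle_inv I n))%E); last first.
  by move=> i j _ _; exact: (pcan_inj pickleK_inv).
rewrite esum_mkcond; apply: eq_esum => n _; case: ifPn => //.
rewrite notin_setE/= => nI; case E: (pickle_inv n) => [i|]//=.
exfalso; apply: nI; exists i => //.
by have := @pickle_invK I n; rewrite E.
Qed.

Lemma esumZl (R : realType) (I : countType) (D : set I) (a : I -> \bar R) (c : R) :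
  0 <= c -> (forall i, 0 <= a i)%E ->
  (\esum_(i in D) (c%:E * a i) = c%:E * \esum_(i in D) a i)%E.
Proof.
move=> c0 a0; rewrite esum_mkcond [in RHS]esum_mkcond !esum_countE.
- rewrite -nneseriesZl; last by move=> n _; case: pickle_inv => //= i; case: ifP.
  apply: eq_eseriesr => n _; case: pickle_inv => [i|]/=; last by rewrite mule0.
  by case: ifP; rewrite ?mule0.
- by move=> i; case: ifP.
- by move=> i; case: ifP => // _; rewrite mule_ge0.
Qed.

Lemma sum_inv_sqr_le (R : realType) n :
  \sum_(0 <= i < n) i.+1%:R ^- 2 <= 2 :> R.
Proof.
(* The bound is sharpened so that the induction closes: with x = m + 1, one step leaves the slack 1
   / (x (x + 1)^2). *)
suff H m : \sum_(0 <= i < m.+1) i.+1%:R ^- 2 <= 2 - m.+1%:R^-1 :> R.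
  case: n => [|n]; first by rewrite big_nil.
  by rewrite (le_trans (H n))// lerBlDr lerDl invr_ge0.
elim: m => [|m IH]; first by rewrite big_nat1 expr1n invr1; lra.
rewrite big_nat_recr//= (le_trans (lerD IH (lexx _)))//.
have m0 : 0 < m.+1%:R :> R by rewrite ltr0n.
rewrite -[m.+2%:R]natr1; move: (m.+1%:R : R) m0 => x m0.
have x1 : x + 1 != 0 by lra.
have x2 : x != 0 by lra.
rewrite -subr_ge0 [X in 0 <= X](_ : _ = x^-1 * (x + 1) ^- 2); last first.
  by field; rewrite x1 x2.
by rewrite mulr_ge0// invr_ge0 ?exprn_ge0// ?addr_ge0// ltW.
Qed.

Lemma prime_partial_prodS (R : realType) (f : nat -> R) n :
  prime_partial_prod f n.+1 =
  prime_partial_prod f n * (if prime n then f n else 1).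
Proof.
by rewrite /prime_partial_prod !(big_mkcond prime)/= big_nat_recr.
Qed.

(** * Euler's sieve for integer exponents s > 1 *)

Section euler_product.
Context (R : realType) (s : nat).
Hypothesis s2 : (1 < s)%N.

Let u (m : nat) : R := m%:R ^- s.

Let u_ge0 m : (0 <= (u m)%:E)%E.
Proof. by rewrite lee_fin invr_ge0 exprn_ge0. Qed.

(** Comparison with the exponent 2, whose partial sums stay below 2. *)
Lemma natVX_series_lty : (\sum_(m <oo) (m.+1%:R ^- s)%:E < +oo :> \bar R)%E.
Proof.
apply: (@le_lt_trans _ _ 2%:E); last by rewrite ltry.
apply: lime_le.
  by apply: is_cvg_ereal_nneg_natsum => n _; exact: u_ge0.
apply: nearW => n; rewrite sumEFin lee_fin.
apply: (@le_trans _ _ (\sum_(0 <= i < n) i.+1%:R ^- 2)).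
  apply: ler_sum => i _; rewrite lef_pV2 ?posrE ?exprn_gt0 ?ltr0n//.
  by rewrite ler_weXn2l// ler1n.
exact: sum_inv_sqr_le.
Qed.

Lemma zetaE : (zeta s%:R : R)%:E = (\sum_(m <oo) (m.+1%:R ^- s)%:E)%E.
Proof.
have E : series (riemannR s%:R) = series (fun m => m.+1%:R ^- s) :> (R ^nat).
  by congr series; apply/funext => m; rewrite /riemannR powR_mulrn.
have cv : cvgn (series (fun m => m.+1%:R ^- s : R)).
  apply: nnseries_is_cvg; last exact: natVX_series_lty.
  by move=> m; rewrite -lee_fin; exact: u_ge0.
rewrite /zeta E -EFin_lim//; congr (limn _); apply/funext => n /=.
by rewrite /series/= sumEFin.
Qed.

(** What survives the sieve by the primes below [n]. The number 1 survives every stage, which gives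
    [S] its limit 1. *)
Let rough n : set nat :=
  [set m | (0 < m)%N /\ forall q, prime q -> (q %| m)%N -> (n <= q)%N].

Let S n := (\esum_(m in rough n) (u m)%:E)%E.

(** Within [rough n], the non-multiples of the prime [n] form [rough n.+1], and the multiples are
    [n] times the elements of [rough n]. The additive form avoids subtraction in [\bar R]. *)
Let S_shift n : prime n -> S n = (S n.+1 + (u n)%:E * S n)%E.
Proof.
move=> pn; rewrite {1}/S (esumID [set m | ~~ (n %| m)%N])//; congr (_ + _)%E.
  congr (esum _ _); apply/seteqP; split => m /=.
    move=> [[m0 h] nm]; split => // q pq qm; rewrite ltn_neqAle h// andbT.
    by apply: contraNneq nm => ->.
  move=> [m0 h]; split; first by split=> // q pq /(h _ pq)/ltnW.
  by apply/negP => /(h _ pn); rewrite ltnn.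
rewrite -esumZl//; last by rewrite -lee_fin.
rewrite [X in esum X _](_ : _ = (fun m => n * m)%N @` rough n); last first.
  apply/seteqP; split => m /=.
    move=> [[m0 h]] /negP; rewrite negbK => /dvdnP[c mE].
    exists c; last by rewrite mE mulnC.
    split; first by move: m0; rewrite mE; case: (c).
    by move=> q pq qc; apply: h => //; rewrite mE dvdn_mulr.
  move=> [c [c0 h] <-]; split; last by apply/negP; rewrite negbK dvdn_mulr.
  split; first by rewrite muln_gt0 prime_gt0.
  move=> q pq; rewrite Euclid_dvdM// => /orP[|/(h _ pq)//].
  by rewrite dvdn_prime2// => /eqP ->.
rewrite esum_image; last first.
  move=> i j _ _ /eqP; rewrite eqn_pmul2l ?prime_gt0//.
  by move/eqP.
apply: eq_esum => m _.
by rewrite -EFinM /u natrM exprMn invfM.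
Qed.

Let S_nprime n : ~~ prime n -> S n.+1 = S n.
Proof.
move=> pn; congr (esum _ _); apply/seteqP; split => m /= [m0 h]; split => // q pq.
  by move/(h _ pq)/ltnW.
move=> qm; rewrite ltn_neqAle h// andbT.
by apply: contraNneq pn => ->.
Qed.

(** The series is indexed by [m.+1], hence the start at [n.-1]; the condition [0 < m] makes [n = 0]
    and [n = 1] give the same sum. *)
Let tailE n : (\esum_(m in [set m | (n <= m)%N /\ (0 < m)%N]) (u m)%:E
  = \sum_(n.-1 <= m <oo) (m.+1%:R ^- s)%:E)%E.
Proof.
rewrite -nneseries_addn// nneseries_esumT//.
apply: (@reindex_esum _ _ _ setT _ (fun i => (i + n.-1).+1) (fun m => (u m)%:E)).
split.
- by move=> i _ /=; split=> //; case: n => //= n; rewrite ltnS leq_addl.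
- by move=> i j _ _ /succn_inj/addIn.
- move=> m /= [nm m0]; exists (m.-1 - n.-1)%N => //.
  by rewrite subnK ?prednK//; case: n m nm m0 => [|n] [|m].
Qed.

Let S0 : S 0%N = (zeta s%:R)%:E.
Proof.
rewrite zetaE -(tailE 0); congr (esum _ _).
by apply/seteqP; split=> m /= [].
Qed.

(** An element of [rough n] above 1 is at least its least prime divisor, hence at least [n], and so
    is counted in the tail. *)
Let S_le n : (S n <= 1 + \sum_(n.-1 <= m <oo) (m.+1%:R ^- s)%:E)%E.
Proof.
have -> : (1 = \esum_(m in [set 1%N]) (u m)%:E)%E.
  by rewrite esum_set1// /u expr1n invr1.
rewrite -tailE /S !(esum_mkcond _ (fun m => (u m)%:E)) -esumD; last 2 first.
- by move=> m _; case: ifP.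
- by move=> m _; case: ifP.
apply: le_esum => m _; case: ifPn => [|_]; last by rewrite adde_ge0//; case: ifP.
rewrite inE => -[m0 h].
have [m1|m1] := leqP m 1%N.
  rewrite [X in (X + _)%E]ifT; first by rewrite leeDl//; case: ifP.
  by rewrite inE/=; apply/eqP; rewrite eqn_leq m1.
rewrite [X in (_ + X)%E]ifT; first by rewrite leeDr//; case: ifP.
rewrite inE/=; split=> //.
by rewrite (leq_trans (h _ (pdiv_prime m1) (pdiv_dvd m)))// pdiv_leq.
Qed.

Let S_ge1 n : (1 <= S n)%E.
Proof.
have -> : (1 = \esum_(m in [set 1%N]) (u m)%:E)%E.
  by rewrite esum_set1// /u expr1n invr1.
rewrite /S !(esum_mkcond _ (fun m => (u m)%:E)).
apply: le_esum => m _; case: ifPn => [|_]; last by case: ifP.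
rewrite inE/= => ->; rewrite ifT// inE; split=> // q pq.
by rewrite dvdn1 => /eqP q1; rewrite q1 in pq.
Qed.

Let S_cvg : S @ \oo --> (1 : \bar R)%E.
Proof.
apply: (@squeeze_cvge _ _ _ _ (cst 1%E) _
  (fun n => 1 + \sum_(n.-1 <= m <oo) (m.+1%:R ^- s)%:E)%E).
- by apply: nearW => n; rewrite S_ge1 S_le.
- exact: cvg_cst.
- rewrite -[X in _ --> X]adde0; apply: cvgeD => //; first exact: cvg_cst.
  rewrite -cvg_shiftS/=.
  apply: nneseries_tail_cvg; first exact: natVX_series_lty.
  by move=> m _; exact: u_ge0.
Qed.

Lemma zeta_gt0 : 0 < (zeta s%:R : R).
Proof. by rewrite -lte_fin -S0 (lt_le_trans _ (S_ge1 0)). Qed.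

Let S_prod n :
  S n = (zeta s%:R * prime_partial_prod (fun p => 1 - p%:R ^- s) n)%:E.
Proof.
elim: n => [|n IH]; first by rewrite S0 /prime_partial_prod big_nil mulr1.
rewrite prime_partial_prodS.
have [pn|pn] := boolP (prime n); last by rewrite mulr1 S_nprime.
have := S_shift pn; rewrite IH; set z := (_ * prime_partial_prod _ n).
(* The left side is finite, so [S n.+1] is not infinite and the equation can be solved in the
   reals. *)
case: (S n.+1) => [y||]// /eqP; rewrite -EFinM -EFinD eqe => /eqP zE.
congr (_%:E); rewrite mulrA -/z mulrBr mulr1 [X in _ = X - _]zE.
by rewrite /u mulrC addrK.
Qed.

(** By [S_prod] the partial product is [S n] divided by the zeta value, and [S n] tends to 1. *)
Lemma euler_product :
  prime_partial_prod (fun p => 1 - p%:R ^- s : R) @ \oo --> (zeta s%:R : R)^-1.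
Proof.
have z0 : zeta s%:R != 0 :> R by rewrite gt_eqF// zeta_gt0.
have -> : prime_partial_prod (fun p => 1 - p%:R ^- s : R) =
    (fun n => (zeta s%:R)^-1 * fine (S n)).
  by apply/funext => n; rewrite S_prod/= mulKf.
rewrite -[X in _ --> X]mulr1; apply: cvgM; first exact: cvg_cst.
exact: fine_cvg S_cvg.
Qed.

End euler_product.

(** * Closed form of the local factor *)

Section box_sums.
Context (R : realType) (k : nat) (x : R).
Hypothesis x0 : 0 <= x.

Definition box (m : nat) : set {ffun 'I_k -> nat} := [set l | forall j, (l j < m)%N].

(** The box is the image of the finite type of maps into ['I_m], where the sum of products factors
    into a power of one geometric sum. *)
Lemma esum_box m :
  (\esum_(l in box m) (x ^+ (\sum_(j < k) l j))%:E =
   ((\sum_(i < m) x ^+ i) ^+ k)%:E)%E.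
Proof.
pose e (f : {ffun 'I_k -> 'I_m}) : {ffun 'I_k -> nat} := [ffun j => f j : nat].
have -> : box m = e @` [set: {ffun 'I_k -> 'I_m}].
  apply/seteqP; split => [l lm|_ [f _ <-] j]; last by rewrite ffunE.
  exists [ffun j => Ordinal (lm j)] => //.
  by apply/ffunP => j; rewrite !ffunE.
rewrite esum_image; last first.
  move=> f g _ _ /ffunP fg; apply/ffunP => j; apply/val_inj.
  by have := fg j; rewrite !ffunE.
transitivity (\esum_(f in [set` (index_enum {ffun 'I_k -> 'I_m})])
    (\prod_(j < k) x ^+ f j)%:E)%E.
  congr esum; first by apply/seteqP; split => // f _; rewrite /= mem_index_enum.
  apply/funext => f; congr (_%:E); rewrite prodrXr.
  by congr (_ ^+ _); apply: eq_bigr => j _; rewrite ffunE.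
rewrite esum_fset; last 2 first.
- exact: finite_seq.
- by move=> f _; rewrite lee_fin prodr_ge0// => j _; rewrite exprn_ge0.
rewrite -fsbig_seq ?index_enum_uniq// sumEFin; congr (_%:E).
rewrite -(bigA_distr_bigA (fun (_ : 'I_k) (i : 'I_m) => x ^+ i)).
by rewrite prodr_const card_ord.
Qed.

(** The level set is [box m.+1] minus [box m]. For [k = 0] this fails: the empty tuple lies in
    [box 0] although its maximum is 0. *)
Lemma esum_max_eq m : (0 < k)%N ->
  (\esum_(l in [set l : {ffun 'I_k -> nat} | (\max_(j < k) l j)%N = m])
     (x ^+ (\sum_(j < k) l j))%:E =
   ((\sum_(i < m.+1) x ^+ i) ^+ k - (\sum_(i < m) x ^+ i) ^+ k)%:E)%E.
Proof.
move=> k0.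
have maxE (l : {ffun 'I_k -> nat}) n : box n l <-> (\max_(j < k) l j < n)%N.
  split=> [ln|ln j]; last exact: leq_ltn_trans (leq_bigmax j) ln.
  elim/big_ind: _ => //; last by move=> a b; rewrite gtn_max => -> ->.
  by rewrite (leq_trans _ (ln (Ordinal k0))).
have := esum_box m.+1; rewrite (esumID (box m))/=; last first.
  by move=> l _; rewrite lee_fin exprn_ge0.
rewrite [X in (esum X _ + _)%E](_ : _ = box m); last first.
  apply/seteqP; split => l /= => [[]//|lm]; split=> //.
  by move=> j; rewrite ltnW// ltnS.
rewrite [X in (_ + esum X _)%E](_ : _ =
    [set l : {ffun 'I_k -> nat} | (\max_(j < k) l j)%N = m]); last first.
  apply/seteqP; split => l /=.
    move=> [/maxE lm] /maxE/negP; rewrite -leqNgt => ml.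
    by apply/eqP; rewrite eqn_leq ml andbT.
  by move=> <-; split; [apply/maxE|move=> /maxE; rewrite ltnn].
rewrite esum_box; case: esum => [y||]//.
by rewrite -EFinD => -[<-]; congr (_%:E); ring.
Qed.
End box_sums.

Section C_closed_form.
Context (R : realType) (r k : nat).

(** Has the exact shape of [F] in the theorem, so that the two are convertible. *)
Definition C_closed (p : nat) : R :=
  (1 - p%:R^-1) ^+ k / (1 - p%:R ^- (r + 1)) ^+ k *
  \sum_(1 <= j < k.+1)
    'C(k, j)%:R * (-1) ^+ (j - 1) *
    ((1 - p%:R ^- (j * (r + 1))) / (1 - p%:R ^- ((j - 1) * (r + 1) + 1))).

Lemma natVX_itvoo (p n : nat) : (1 < p)%N -> (0 < n)%N ->
  0 < (p%:R ^- n : R) < 1.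
Proof.
move=> p1 n0; rewrite invr_gt0 exprn_gt0 ?ltr0n ?(ltnW p1)//=.
by rewrite invf_lt1 ?exprn_gt0 ?ltr0n ?(ltnW p1)// exprn_egt1 ?ltr1n -?lt0n.
Qed.

(** The terms of index 0 of the two binomial expansions cancel. What remains depends on [m] only
    through [(y ^+ j) ^+ m], ready to be summed as geometric series. *)
Lemma powB_binomial (y : R) m :
  (1 - y ^+ m.+1) ^+ k - (1 - y ^+ m) ^+ k =
  \sum_(1 <= j < k.+1) 'C(k, j)%:R * (-1) ^+ (j - 1) * (1 - y ^+ j) * (y ^+ j) ^+ m.
Proof.
rewrite !exprDn -sumrB big_ord_recl/= !expr0 subrr add0r.
rewrite [RHS]big_add1/= big_mkord; apply: eq_bigr => i _.
rewrite subn1/= /bump/= add1n !expr1n !mul1r -mulrnBl -[LHS]mulr_natl -!mulrA.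
have signE (a : R) : (- a) ^+ i.+1 = - ((-1) ^+ i * a ^+ i.+1).
  by rewrite [LHS]exprNn exprSr mulrN1 mulNr.
rewrite !signE -!exprM mulSn exprD [(m * _)%N]mulnC.
set a := y ^+ _; set b := y ^+ _; set c := (-1) ^+ _; set w := 'C(_, _)%:R.
move: a b c w => a b c w; ring.
Qed.

Let C_term_expr p : (1 < p)%N -> forall l : {ffun 'I_k -> nat},
  C_term R r p l =
  p%:R ^+ (r * \max_(j < k) l j) * (p%:R ^- (r + 1)) ^+ (\sum_(j < k) l j).
Proof. by move=> p1 l; rewrite /C_term addn1 exprVn -exprM. Qed.

Lemma C_term_ge0 p (l : {ffun 'I_k -> nat}) : 0 <= C_term R r p l.
Proof. by rewrite divr_ge0 ?exprn_ge0. Qed.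

(** Nonnegativity lets the tuples be grouped by their maximum [m]. Each layer is a sum of [k]
    geometric terms in [m], and summing over [m] produces the inner denominators. *)
Lemma esum_C_term p : (0 < k)%N -> (1 < p)%N ->
  (\esum_(l in [set: {ffun 'I_k -> nat}]) (C_term R r p l)%:E)%E =
  ((1 - p%:R ^- (r + 1)) ^- k *
  \sum_(1 <= j < k.+1)
    'C(k, j)%:R * (-1) ^+ (j - 1) *
    ((1 - p%:R ^- (j * (r + 1))) / (1 - p%:R ^- ((j - 1) * (r + 1) + 1))))%:E.
Proof.
move=> k0 p1; set x : R := p%:R ^- (r + 1).
have /andP[x0 x1] : 0 < x < 1 by apply: natVX_itvoo; rewrite // addn1.
have pn0 : p%:R != 0 :> R by rewrite pnatr_eq0 -lt0n ltnW.
pose J m := [set l : {ffun 'I_k -> nat} | (\max_(j < k) l j)%N = m].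
rewrite [X in esum X](_ : _ = \bigcup_(m in [set: nat]) J m); last first.
  by apply/seteqP; split => // l _; exists (\max_(j < k) l j)%N.
rewrite esum_bigcupT; last 2 first.
- by move=> i j _ _ [l [<- <-]].
- by move=> l; rewrite lee_fin C_term_ge0.
(* The ratio of the [j]-th geometric series, which for [j >= 1] is [p%:R ^+ r * x ^+ j]. Written as
   a negative power of [p], it visibly lies in ]0, 1[. *)
pose z j : R := p%:R ^- ((j - 1) * (r + 1) + 1).
pose c j : R := 'C(k, j)%:R * (-1) ^+ (j - 1) * (1 - x ^+ j) * (1 - x) ^- k.
have layer m : (\esum_(l in J m) (C_term R r p l)%:E =
    (\sum_(1 <= j < k.+1) geometric (c j) (z j) m)%:E)%E.
  transitivity (\esum_(l in J m) ((p%:R ^+ (r * m))%:E *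
      (x ^+ (\sum_(j < k) l j))%:E))%E.
    by apply: eq_esum => l <-; rewrite -EFinM C_term_expr.
  rewrite esumZl ?exprn_ge0//; last by move=> l; rewrite lee_fin exprn_ge0// ltW.
  rewrite esum_max_eq// ?(ltW x0)// -EFinM; congr (_%:E).
  have geo n : \sum_(i < n) x ^+ i = (1 - x ^+ n) / (1 - x).
    have := geometric_seriesE 1 (negbT (lt_eqF x1)); move=> /(congr1 (fun f => f n)).
    rewrite /series/= big_mkord mul1r => <-.
    by apply: eq_bigr => i _; rewrite mul1r.
  rewrite !geo !expr_div_n -mulrBl powB_binomial mulr_suml mulr_sumr.
  rewrite big_nat [RHS]big_nat; apply: eq_bigr => j /andP[j1 _].
  rewrite /= /c.
  have -> : z j = p%:R ^+ r * x ^+ j.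
    (* Multiplying by p^((r+1)j) leaves the exponent identity (r+1)j = r + ((j-1)(r+1) + 1), valid
       since j >= 1. *)
    rewrite /z /x exprVn -exprM; apply: (mulfI (expf_neq0 ((r + 1) * j) pn0)).
    rewrite mulrCA mulfV ?expf_neq0// mulr1; case: j j1 => // j _.
    rewrite subn1/= (_ : ((r + 1) * j.+1 = r + (j * (r + 1) + 1))%N); last first.
      by rewrite mulnC mulSn -addnA (addnC 1%N).
    by rewrite exprD mulfK ?expf_neq0.
  by rewrite exprMn (exprM _ r); ring.
rewrite (eq_esum (fun m _ => layer m)) -nneseries_esumT; last first.
  move=> m; rewrite -layer esum_ge0// => l _.
  by rewrite lee_fin C_term_ge0.
have cv : series (fun m => \sum_(1 <= j < k.+1) geometric (c j) (z j) m) @ \oo -->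
   \sum_(1 <= j < k.+1) c j * (1 - z j)^-1.
  rewrite [X in X @ _ --> _](_ : _ =
     (fun n => \sum_(1 <= j < k.+1) series (geometric (c j) (z j)) n)); last first.
    by apply/funext => n; rewrite /series/= exchange_big.
  apply: cvg_big => [|j _]; first exact: add_continuous.
  apply: cvg_geometric_series.
  have /andP[z0 z1] : 0 < z j < 1 by apply: natVX_itvoo; rewrite ?addn1.
  by rewrite ger0_norm ?ltW.
transitivity (limn (EFin \o
  series (fun m => \sum_(1 <= j < k.+1) geometric (c j) (z j) m))).
  by congr (limn _); apply/funext => n; rewrite /= sumEFin.
rewrite EFin_lim; last exact: cvgP cv.
rewrite (cvg_lim _ cv)//; congr (_%:E); rewrite mulr_sumr.
apply: eq_bigr => j _; rewrite /c -/(z j) [in RHS]mulnC exprM exprVn -/x.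
by ring.
Qed.

Lemma C_factorE p : (0 < k)%N -> (1 < p)%N -> C_factor R r k p = C_closed p.
Proof. by move=> k0 p1; rewrite /C_factor esum_C_term//= /C_closed mulrA. Qed.

Lemma summable_C_term p : (0 < k)%N -> (1 < p)%N ->
  summable [set: {ffun 'I_k -> nat}] (fun l => (C_term R r p l)%:E).
Proof.
move=> k0 p1; rewrite /summable (eq_esum (b := fun l => (C_term R r p l)%:E)).
  by rewrite esum_C_term// ltry.
by move=> l _; rewrite gee0_abs// lee_fin C_term_ge0.
Qed.

End C_closed_form.

(** * Products of independent discrete variables *)

(** The values of [X] form a countable type, so the preimage of any set is a countable union of
    fibres of [X]. *)
Lemma measurable_comp_countable d (T : measurableType d) d' (U : measurableType d')
    (I : countType) (X : T -> I) (f : I -> U) :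
  (forall l, measurable (X @^-1` [set l])) -> measurable_fun setT (f \o X).
Proof.
move=> mX _ B mB; rewrite setTI.
pose A n := if @pickle_inv I n is Some l then
  (if f l \in B then X @^-1` [set l] else set0) else set0.
rewrite [X in measurable X](_ : _ = \bigcup_n A n).
  apply: bigcupT_measurable => n; rewrite /A.
  by case: pickle_inv => // l; case: ifP.
apply/seteqP; split => [x /= Bx|x [n _]].
  exists (choice.pickle (X x)) => //; rewrite /A pickleK_inv.
  by rewrite ifT// inE.
rewrite /A; case: pickle_inv => // l; case: ifPn => // /[!inE] Bl /= ->.
exact: Bl.
Qed.

Section independent_product.
Context d (T : measurableType d) (R : realType) (P : probability T R).
Context (I : countType) (K : eqType) (X : K -> T -> I) (w f : K -> I -> R).
Context (Q : pred K).
Hypothesis mX : forall p l, measurable (X p @^-1` [set l]).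
Hypothesis w0 : forall p l, 0 <= w p l.
Hypothesis f0 : forall p l, 0 <= f p l.

(** The boolean [all] makes the indicator a product of boolean casts along [s], suited to induction
    on the list. *)
Definition cylinder (s : seq K) (b : K -> I) : set T :=
  [set x | all (fun p => X p x == b p) s].

Hypothesis PX : forall (s : seq K) (b : K -> I), uniq s -> all Q s ->
  P (cylinder s b) = (\prod_(p <- s) w p (b p))%:E.

Context (c : K -> R).
Hypothesis fwc : forall p, Q p ->
  (\esum_(l in [set: I]) (f p l * w p l)%:E = (c p)%:E)%E.

Let mcyl s b : measurable_fun setT (fun x => (all (fun p => X p x == b p) s)%:R : R).
Proof.
elim: s => [|p s IH] /=; first exact: measurable_cst.
under eq_fun do rewrite -mulnb natrM.
apply: measurable_funM => //.
exact: (@measurable_comp_countable _ _ _ _ _ (X p) (fun l => (l == b p)%:R : R)).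
Qed.

(* The event [cylinder t b] is carried along so that the induction on [s] can
   fix the value of [X a] by moving [a] from [s] to [t]. *)
Lemma integral_independent_prod (s t : seq K) (b : K -> I) :
  uniq (s ++ t) -> all Q (s ++ t) ->
  (\int[P]_x ((all (fun p => X p x == b p) t)%:R *
              \prod_(p <- s) f p (X p x))%:E =
  (\prod_(p <- s) c p * \prod_(p <- t) w p (b p))%:E)%E.
Proof.
have mprod s' : measurable_fun setT (fun x => \prod_(p <- s') f p (X p x)).
  apply: measurable_prod => p _.
  exact: (@measurable_comp_countable _ _ _ _ _ (X p) (f p)).
elim: s t b => [|a s IH] t b /=.
  move=> ut Qt; rewrite big_nil mul1r -PX//.
  under eq_integral do rewrite big_nil mulr1.
  rewrite -[cylinder t b]setIT -integral_indic//.
    apply: eq_integral => x _; congr (_%:E); rewrite indicE.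
    by congr ((nat_of_bool _)%:R); apply/idP/idP; rewrite inE.
  have := mcyl t b measurableT (measurable_set1 1); rewrite setTI.
  congr measurable; apply/seteqP; split => x /=.
    by move=> /eqP; rewrite pnatr_eq1 eqb1.
  by rewrite /cylinder/= => ->.
move=> /andP[+ ust] /andP[Qa Qst]; rewrite mem_cat negb_or => /andP[nas ta].
(* Prescribes the value [l] at [a]; it agrees with [b] on [t] because [a] does not occur there. *)
pose b' l p := if p == a then l else b p.
have b't l p : p \in t -> b' l p = b p.
  by rewrite /b'; case: eqP => // -> /(negP ta).
pose h (l : I) (x : T) : \bar R :=
  ((f a l)%:E * ((all (fun p => X p x == b' l p) (a :: t))%:R *
              \prod_(p <- s) f p (X p x))%:E)%E.
have h0 l x : (0 <= h l x)%E.
  by rewrite mule_ge0 ?lee_fin ?f0// mulr_ge0// prodr_ge0.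
have intE x : (((all (fun p => X p x == b p) t)%:R *
    \prod_(p <- (a :: s)) f p (X p x))%:E = \esum_(l in [set: I]) h l x)%E.
  (* Only the value [l = X a x] contributes to the sum over [l]. *)
  rewrite (esumID [set X a x])// setTI setTI esum_set1// esum1; last first.
    move=> l /eqP; rewrite eq_sym => /negbTE lX.
    by rewrite /h/= /b' eqxx lX mul0r mule0.
  rewrite adde0 /h /= {1}/b' !eqxx/= big_cons -EFinM mulrCA; congr (_ * (_ * _))%:E.
  by congr ((nat_of_bool _)%:R); apply: eq_in_all => p /b't ->.
under eq_integral do rewrite intE esum_countE//.
(* Nonnegativity allows the integral and the sum over the values of [X a] to be exchanged. *)
rewrite integral_nneseries//; last 2 first.
- move=> n; case: pickle_inv => [l|]/=; last exact: measurable_cst.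
  apply: measurable_funeM; apply/measurable_EFinP; apply: measurable_funM => //.
- by move=> n x _; case: pickle_inv => //= l; exact: h0.
transitivity (\sum_(n <oo) ((\prod_(p <- s) c p * \prod_(p <- t) w p (b p))%:E *
    oapp (fun l => (f a l * w a l)%:E) 0 (@pickle_inv I n)))%E.
  apply: eq_eseriesr => n _; case: pickle_inv => [l|]/=; last first.
    by rewrite integral0 mule0.
  rewrite ge0_integralZl_EFin//; last 2 first.
  - by move=> x _; rewrite lee_fin mulr_ge0// prodr_ge0.
  - apply/measurable_EFinP.
    by apply: measurable_funM => //; exact: (mcyl (a :: t) (b' l)).
  rewrite (IH (a :: t) (b' l)); last 2 first.
  - rewrite (perm_uniq (introT permPl (perm_catCA s [:: a] t)))/=.
    by rewrite mem_cat negb_or nas ta.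
  - by rewrite (perm_all _ (introT permPl (perm_catCA s [:: a] t)))/= Qa.
  rewrite big_cons {1}/b' eqxx -!EFinM; congr (_%:E).
  rewrite (@eq_big_seq _ _ _ _ t (fun p => w p (b' l p)) (fun p => w p (b p))).
    by ring.
  by move=> p /b't ->.
rewrite nneseriesZl; last first.
  by move=> n _; case: pickle_inv => //= l; rewrite lee_fin mulr_ge0.
rewrite -esum_countE; last by move=> l; rewrite lee_fin mulr_ge0.
by rewrite fwc// -EFinM big_cons; congr (_%:E); ring.
Qed.

End independent_product.

(** * Moments of R_k *)

Lemma prime_partial_prod_itv01 (R : realType) (f : nat -> R) n :
  (forall p, prime p -> 0 <= f p <= 1) -> 0 <= prime_partial_prod f n <= 1.
Proof.
move=> f01; rewrite /prime_partial_prod; elim/big_rec: _ => [|p y pp /andP[y0 y1]].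
  by rewrite ler01 lexx.
by have /andP[f0 f1] := f01 p pp; rewrite mulr_ge0//= mulr_ile1.
Qed.

(** The partial products are nonincreasing and bounded below by 0. *)
Lemma prime_prod_cvg_itv01 (R : realType) (f : nat -> R) :
  (forall p, prime p -> 0 <= f p <= 1) -> prime_prod_cvg f.
Proof.
move=> f01; apply: nonincreasing_is_cvgn.
  apply/nonincreasing_seqP => n; rewrite prime_partial_prodS.
  have /andP[p0 _] := prime_partial_prod_itv01 n f01.
  by case: ifPn => [/f01/andP[_ f1]|_]; rewrite ?mulr1// ler_piMr.
by exists 0 => _ [n _ <-]; case/andP: (prime_partial_prod_itv01 n f01).
Qed.

Lemma eq_prime_partial_prod (R : realType) (f g : nat -> R) :
  (forall p, prime p -> f p = g p) -> prime_partial_prod f = prime_partial_prod g.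
Proof. by move=> fg; apply/funext => n; apply: eq_bigr. Qed.

Lemma prime_partial_prodX (R : realType) (f : nat -> R) m n :
  prime_partial_prod (fun p => f p ^+ m) n = prime_partial_prod f n ^+ m.
Proof. by rewrite /prime_partial_prod prodrXl. Qed.

(** Covers [p = 0] as well, where the inverse of 0 is 0, because [w0] and [f01] range over every
    index and not only over primes. *)
Lemma natVX_itvcc (R : realType) (p n : nat) : 0 <= (p%:R ^- n : R) <= 1.
Proof.
rewrite invr_ge0 exprn_ge0//=; case: p => [|p].
  by case: n => [|n]; rewrite ?expr0 ?invr1// expr0n invr0.
by rewrite invf_le1 ?exprn_gt0 ?ltr0n// exprn_ege1// ler1n.
Qed.

Section moments.
Context d (T : measurableType d) (R : realType) (P : probability T R).
Context (k : nat) (G : 'I_k -> nat -> {RV P >-> nat}) (r : nat).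
Hypothesis k0 : (0 < k)%N.
Hypothesis geomG : geometric_family G.

(** The [k] variables at [p] are bundled into one variable with values in a countable type; for [p]
    prime, [w p] is its law, and [f p] reads off the [r]-th power of the factor of [Rk] at [p]. *)
Let X (p : nat) (x : T) : {ffun 'I_k -> nat} := [ffun j => G j p x].
Let w (p : nat) (l : {ffun 'I_k -> nat}) : R :=
  \prod_(j < k) ((1 - p%:R^-1) * p%:R ^- l j).
Let f (p : nat) (l : {ffun 'I_k -> nat}) : R :=
  p%:R ^- (r * (\sum_(j < k) l j - \max_(j < k) l j)).

Let mX p l : measurable (X p @^-1` [set l]).
Proof.
rewrite [X in measurable X](_ : _ =
    \bigcap_(j in [set: 'I_k]) (G j p @^-1` [set l j])).
  apply: fin_bigcap_measurable => // j _.
  by rewrite -[_ @^-1` _]setTI; exact: measurable_funPT.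
apply/seteqP; split=> [x /= Xl j _|x xl /=].
  by rewrite /= -Xl ffunE.
by apply/ffunP => j; rewrite ffunE; exact: xl.
Qed.

Let w0 p l : 0 <= w p l.
Proof.
apply: prodr_ge0 => j _; rewrite mulr_ge0 ?invr_ge0 ?exprn_ge0// subr_ge0.
by have /andP[_] := natVX_itvcc R p 1; rewrite expr1.
Qed.

Let f01 p l : 0 <= f p l <= 1. Proof. exact: natVX_itvcc. Qed.

(** Independence is applied to all pairs [(j, p)] with [p] in [s]; the product over pairs is then
    regrouped prime by prime. *)
Let PX (s : seq nat) (b : nat -> {ffun 'I_k -> nat}) : uniq s -> all prime s ->
  P (cylinder X s b) = (\prod_(p <- s) w p (b p))%:E.
Proof.
move=> us ps; have [indG lawG] := geomG.
pose s' := [seq (j, p) | p <- s, j <- enum 'I_k].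
have s'P i : (i \in s') = (i.2 \in s).
  case: i => j p; apply/allpairsPdep/idP => [[p' [j' [? _ [_ ->]]]]//|/= sp].
  by exists p, j; rewrite mem_enum.
pose J : {fset 'I_k * nat} := [fset i in s']%fset.
have JE i : (i \in J) = (i.2 \in s) by rewrite !inE/= s'P.
have us' : uniq s'.
  apply: allpairs_uniq_dep => //; first by move=> *; exact: enum_uniq.
  by move=> [p j] [p' j'] _ _ /= [-> ->].
rewrite [cylinder X s b](_ : _ = \bigcap_(i in [set` J])
    (G i.1 i.2 @^-1` [set b i.2 i.1])).
  rewrite (indG J (fun i => [set b i.2 i.1]))//; last first.
    by move=> i /=; rewrite JE => /(allP ps).
  rewrite (perm_big s')/=; last first.
    by apply: uniq_perm; rewrite ?fset_uniq// => i; rewrite JE s'P.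
  rewrite big_allpairs_dep/= -prodEFin; apply: eq_big_seq => p sp.
  rewrite /w big_enum/= -prodEFin; apply: eq_bigr => j _.
  exact: lawG (allP ps _ sp).
apply/seteqP; split => [x /= /allP Xb [j p] /=|x xb].
  by rewrite JE => /Xb/eqP <-; rewrite ffunE.
apply/allP => p sp; apply/eqP/ffunP => j; rewrite ffunE.
by apply: (xb (j, p)) => /=; rewrite JE.
Qed.

(** With S the sum and M the maximum of [l], the exponents of 1/p add up to r(S - M) + S = (r+1)S -
    rM, which is that of [C_term]. *)
Let f_sum p : prime p ->
  (\esum_(l in [set: {ffun 'I_k -> nat}]) (f p l * w p l)%:E =
   (C_factor R r k p)%:E)%E.
Proof.
move=> pp; have p1 := prime_gt1 pp.
have pn0 : p%:R != 0 :> R by rewrite pnatr_eq0 -lt0n prime_gt0.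
transitivity (\esum_(l in [set: {ffun 'I_k -> nat}])
    (((1 - p%:R^-1) ^+ k)%:E * (C_term R r p l)%:E))%E.
  apply: eq_esum => l _; rewrite -EFinM; congr (_%:E).
  rewrite /w big_split/= prodr_const card_ord mulrCA; congr (_ * _).
  under eq_bigr do rewrite -exprVn.
  rewrite prodrXr exprVn /C_term /f.
  set S := (\sum_(j < k) l j)%N; set M := (\max_(j < k) l j)%N.
  have MS : (M <= S)%N.
    by apply/bigmax_leqP => j _; rewrite /S (bigD1 j)//= leq_addr.
  (* The inequality [MS] makes the truncated subtraction exact. *)
  have -> : (r.+1 * S = S + (r * (S - M) + r * M))%N by rewrite mulSn -mulnDr subnK.
  rewrite !exprD.
  have a0 : p%:R ^+ (r * (S - M)) != 0 :> R by rewrite expf_neq0.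
  have b0 : p%:R ^+ (r * M) != 0 :> R by rewrite expf_neq0.
  have c0 : p%:R ^+ S != 0 :> R by rewrite expf_neq0.
  move: (p%:R ^+ (r * (S - M)) : R) (p%:R ^+ (r * M) : R) (p%:R ^+ S : R) a0 b0 c0.
  by move=> a b c a0 b0 c0; field; rewrite a0 b0 c0.
rewrite esumZl; last 2 first.
- by rewrite exprn_ge0// subr_ge0 invf_le1 ?ltr0n ?ler1n prime_gt0.
- by move=> l; rewrite lee_fin C_term_ge0.
by rewrite /C_factor esum_C_term//= -EFinM.
Qed.

Let fX p x : f p (X p x) = p%:R ^- (r * Zk G p x).
Proof.
rewrite /f /Zk; congr (_ ^- (r * (_ - _))).
  by apply: eq_bigr => j _; rewrite ffunE.
by apply: eq_bigr => j _; rewrite ffunE.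
Qed.

Lemma expectation_partial_prod n :
  (\int[P]_x (prime_partial_prod (fun p => p%:R ^- (r * Zk G p x)) n)%:E =
   (prime_partial_prod (C_factor R r k) n)%:E)%E.
Proof.
(* No values are fixed, as [t] is empty; the zero tuple passed for [b] is an arbitrary filler. *)
have := @integral_independent_prod _ T R P _ _ X w f prime mX w0
  (fun p l => proj1 (andP (f01 p l))) PX (C_factor R r k) f_sum
  [seq p <- index_iota 0 n | prime p] [::] (fun _ => [ffun _ => 0%N]).
rewrite cats0 big_nil mulr1 => intE.
rewrite /prime_partial_prod -[in RHS]big_filter -intE.
- apply: eq_integral => x _; rewrite /= mul1r -big_filter; congr (_%:E).
  by apply: eq_bigr => p _; rewrite fX.
- by rewrite filter_uniq// iota_uniq.
- exact: filter_all.
Qed.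

Let partial_prod_cvg x :
  prime_partial_prod (fun p => p%:R ^- (r * Zk G p x) : R) @ \oo --> Rk G x ^+ r.
Proof.
rewrite (_ : prime_partial_prod _ =
    (fun n => prime_partial_prod (fun p => p%:R ^- Zk G p x) n ^+ r)).
  have := @exprn_continuous R r (Rk G x); apply: cvg_comp.
  by apply: prime_prod_cvg_itv01 => p _; exact: natVX_itvcc.
apply/funext => n; rewrite -prime_partial_prodX.
by apply: eq_bigr => p _; rewrite exprVn -exprM mulnC.
Qed.

Lemma RkX x : Rk G x ^+ r = prime_prod (fun p => p%:R ^- (r * Zk G p x)).
Proof. by rewrite /prime_prod (cvg_lim _ (@partial_prod_cvg x)). Qed.

(** Dominated convergence with the constant bound 1. It also gives the convergence of the product of
    the [C_factor], without a separate estimate of the factors. *)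
Lemma moment_cvg :
  'E_P[(fun x => Rk G x ^+ r)%R]%E \is a fin_num /\
  prime_partial_prod (C_factor R r k) @ \oo -->
    fine ('E_P[(fun x => Rk G x ^+ r)%R]%E).
Proof.
pose h n x : \bar R := (prime_partial_prod (fun p => p%:R ^- (r * Zk G p x)) n)%:E.
have mh n : measurable_fun setT (h n).
  apply/measurable_EFinP.
  rewrite /prime_partial_prod; under eq_fun do rewrite -big_filter.
  apply: measurable_prod => p _.
  under eq_fun do rewrite -fX.
  exact: (measurable_comp_countable (f p) (mX p)).
have hR x : h ^~ x @ \oo --> (Rk G x ^+ r)%:E.
  by apply: cvg_EFin; [exact: nearW|exact: partial_prod_cvg].
have [] := @dominated_convergence _ _ _ P setT measurableT h
  (fun x => (Rk G x ^+ r)%:E) (cst 1%:E) mh _ _ _ _.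
- by apply: emeasurable_fun_cvg mh _ => x _; exact: hR.
- by apply: aeW => x _; exact: hR.
- exact: finite_measure_integrable_cst.
- apply: aeW => x n _; rewrite /h/= lee_fin.
  have /andP[q0 q1] := prime_partial_prod_itv01 n
    (fun p (_ : prime p) => natVX_itvcc R p (r * Zk G p x)).
  by rewrite ger0_norm.
move=> /integrable_fin_num fE0 _ cE; have fE := fE0 measurableT.
rewrite unlock fE//; split=> //.
rewrite -(fineK fE) in cE.
rewrite (_ : prime_partial_prod _ = (fun n => fine (\int[P]_x h n x)%E)).
  exact: fine_cvg cE.
by apply/funext => n; rewrite expectation_partial_prod.
Qed.

End moments.

(** * Evaluation of the local factors and of their products for k = 1, 2, 3 *)

Section limits.
Context (R : realType) (r : nat).

Lemma C_factor_partial_prod k : (0 < k)%N ->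
  prime_partial_prod (C_factor R r k) = prime_partial_prod (C_closed R r k).
Proof.
by move=> k0; apply: eq_prime_partial_prod => p /prime_gt1; exact: C_factorE.
Qed.

Lemma C_closed1 p : (1 < p)%N -> C_closed R r 1 p = 1.
Proof.
move=> p1; rewrite /C_closed big_nat1 subnn mul0n add0n bin1 expr0.
rewrite !mulr1 mul1n mul1r !expr1.
have /andP[_ q1] := @natVX_itvoo R p 1 p1 isT.
have /andP[_ x1] := @natVX_itvoo R p (r + 1) p1 (ltn_addl r (ltn0Sn 0)).
rewrite expr1 in q1.
by rewrite mulrA divfK ?mulfV// subr_eq0 gt_eqF.
Qed.

(** A rational identity in q = 1/p and x = p^(-(r+1)): every power of p that occurs is a monomial in
    these two. *)
Lemma C_closed2 p : (1 < p)%N ->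
  C_closed R r 2 p = (1 - p%:R ^- 2) / (1 - p%:R ^- (r + 2)).
Proof.
move=> p1; rewrite /C_closed big_nat_recr//= big_nat1.
rewrite subnn subSnn !mul0n !add0n !mul1n bin1 binn expr0 expr1 mulr1 !mul1r expr1.
have -> : p%:R ^- (2 * (r + 1)) = (p%:R ^- (r + 1)) ^+ 2 :> R.
  by rewrite exprVn -exprM mulnC.
have -> : p%:R ^- (r + 1 + 1) = p%:R^-1 * p%:R ^- (r + 1) :> R.
  by rewrite exprD expr1 invfM mulrC.
have -> : p%:R ^- (r + 2) = p%:R^-1 * p%:R ^- (r + 1) :> R.
  by rewrite (addnA r 1 1) exprD expr1 invfM mulrC.
rewrite -(exprVn p%:R 2).
have /andP[q0 q1] := @natVX_itvoo R p 1 p1 isT.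
have /andP[x0 x1] := @natVX_itvoo R p (r + 1) p1 (ltn_addl r (ltn0Sn 0)).
rewrite expr1 in q0 q1.
move: (p%:R^-1 : R) (p%:R ^- (r + 1) : R) q0 q1 x0 x1 => q x q0 q1 x0 x1.
have qx1 : q * x < 1 by rewrite mulr_ilt1 ?ltW.
by field; rewrite !subr_eq0 !gt_eqF.
Qed.

Lemma C_closed3 p : (1 < p)%N ->
  C_closed R r 3 p =
  (1 - p%:R^-1) ^+ 2 * (1 + 2 / p%:R + 2 / p%:R ^+ (r + 2) + 1 / p%:R ^+ (r + 3)) /
  ((1 - p%:R ^- (r + 2)) * (1 - p%:R ^- (2 * r + 3))).
Proof.
move=> p1; rewrite /C_closed big_nat_recr//= big_nat_recr//= big_nat1.
rewrite subnn subSnn !mul0n !add0n !mul1n bin1 binn expr0 expr1 mulr1 !mul1r expr1.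
rewrite (_ : 'C(3, 2) = 3%N)// (_ : (3 - 1 = 2)%N)//.
have -> : p%:R ^- (2 * (r + 1)) = (p%:R ^- (r + 1)) ^+ 2 :> R.
  by rewrite exprVn -exprM mulnC.
have -> : p%:R ^- (3 * (r + 1)) = (p%:R ^- (r + 1)) ^+ 3 :> R.
  by rewrite exprVn -exprM mulnC.
have -> : p%:R ^- (2 * (r + 1) + 1) = p%:R^-1 * (p%:R ^- (r + 1)) ^+ 2 :> R.
  by rewrite exprVn -exprM mulnC exprD expr1 invfM mulrC.
have -> : p%:R ^- (2 * r + 3) = p%:R^-1 * (p%:R ^- (r + 1)) ^+ 2 :> R.
  rewrite exprVn -exprM (_ : 2 * r + 3 = (r + 1) * 2 + 1)%N; last first.
    by rewrite mulnDl -addnA mulnC.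
  by rewrite exprD expr1 invfM mulrC.
have -> : p%:R ^- (r + 1 + 1) = p%:R^-1 * p%:R ^- (r + 1) :> R.
  by rewrite exprD expr1 invfM mulrC.
have E2 : (p%:R ^+ (r + 2))^-1 = p%:R^-1 * p%:R ^- (r + 1) :> R.
  by rewrite (addnA r 1 1) exprD expr1 invfM mulrC.
have -> : (p%:R ^+ (r + 3))^-1 = p%:R^-1 ^+ 2 * p%:R ^- (r + 1) :> R.
  by rewrite (addnA r 1 2) exprD invfM mulrC exprVn.
rewrite !E2.
have /andP[q0 q1] := @natVX_itvoo R p 1 p1 isT.
have /andP[x0 x1] := @natVX_itvoo R p (r + 1) p1 (ltn_addl r (ltn0Sn 0)).
rewrite expr1 in q0 q1.
move: (p%:R^-1 : R) (p%:R ^- (r + 1) : R) q0 q1 x0 x1 => q x q0 q1 x0 x1.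
(* With [q1] and [x1], these bounds keep the denominators 1 - q, 1 - x, 1 - q x and 1 - q x^2 away
   from 0. *)
have qx1 : q * x < 1 by rewrite mulr_ilt1 ?ltW.
have qx21 : q * x ^+ 2 < 1 by rewrite expr2 mulrA mulr_ilt1 ?mulr_ge0 ?ltW.
by field; rewrite !subr_eq0 !gt_eqF.
Qed.

Let F3 (p : nat) : R :=
  (1 - p%:R^-1) ^+ 2 *
  (1 + 2 / p%:R + 2 / p%:R ^+ (r + 2) + 1 / p%:R ^+ (r + 3)).

(** Makes the product of [F3] converge through [prime_prod_cvg_itv01]. *)
Lemma F3_itv01 p : prime p -> 0 <= F3 p <= 1.
Proof.
move=> /prime_gt1 p1; rewrite /F3.
have /andP[] := @natVX_itvoo R p 1 p1 isT; rewrite expr1 => q0 q1.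
have le_pow m n : (m <= n)%N -> (p%:R ^+ n)^-1 <= (p%:R ^+ m)^-1 :> R.
  move=> mn; rewrite lef_pV2 ?posrE ?exprn_gt0 ?ltr0n ?(ltnW p1)//.
  by rewrite ler_weXn2l// ler1n ltnW.
have a0 : 0 < (p%:R ^+ (r + 2))^-1 :> R.
  by rewrite invr_gt0 exprn_gt0 ?ltr0n ?(ltnW p1).
have b0 : 0 < (p%:R ^+ (r + 3))^-1 :> R.
  by rewrite invr_gt0 exprn_gt0 ?ltr0n ?(ltnW p1).
have := le_pow 2 (r + 2)%N (leq_addl _ _); have := le_pow 3 (r + 3)%N (leq_addl _ _).
rewrite -!exprVn; rewrite -!exprVn in a0 b0.
move: (p%:R^-1 : R) (p%:R^-1 ^+ (r + 2) : R) (p%:R^-1 ^+ (r + 3) : R) q0 q1 a0 b0.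
move=> q a b q0 q1 a0 b0 bq aq; apply/andP; split.
  by rewrite mulr_ge0 ?exprn_ge0 ?subr_ge0 ?ltW//; lra.
(* The value at r = 0 is the largest and equals (1 - q^2)(1 - q^3). *)
apply: (@le_trans _ _ ((1 - q) ^+ 2 * (1 + 2 * q + 2 * q ^+ 2 + q ^+ 3))).
  by rewrite ler_wpM2l ?sqr_ge0//; lra.
rewrite (_ : _ * _ = (1 - q ^+ 2) * (1 - q ^+ 3)); last by ring.
by rewrite mulr_ile1 ?subr_ge0 ?exprn_ile1 ?gerBl ?exprn_ge0 ?ltW.
Qed.

(** Numerator and denominator of [C_closed2] form separate Euler products, with exponents 2 and r +
    2. *)
Lemma C_factor2_cvg :
  prime_partial_prod (C_factor R r 2) @ \oo -->
    (zeta (r + 2)%:R / zeta 2 : R).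
Proof.
rewrite C_factor_partial_prod//.
have -> : prime_partial_prod (C_closed R r 2) = (fun n =>
    (prime_partial_prod (fun p => 1 - p%:R ^- (r + 2)) n)^-1 *
    prime_partial_prod (fun p => 1 - p%:R ^- 2) n).
  apply/funext => n; rewrite mulrC -prodf_div; apply: eq_bigr => p /prime_gt1.
  exact: C_closed2.
apply: cvgM; last exact: (@euler_product R 2).
have r2 : (1 < r + 2)%N by rewrite leq_addl.
(* The limit is written as the inverse of an inverse to match the inverted Euler product. *)
rewrite -[X in _ --> X]invrK; apply: cvgV; last exact: euler_product.
by rewrite invr_neq0// gt_eqF// zeta_gt0.
Qed.

(** The two denominators of [C_closed3] give Euler products; the numerator is [F3], whose product is
    kept as it stands. *)
Lemma C_factor3_cvg :
  prime_partial_prod (C_factor R r 3) @ \oo -->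
    (zeta (r + 2)%:R * zeta (2 * r + 3)%:R * prime_prod F3 : R).
Proof.
rewrite C_factor_partial_prod//.
have -> : prime_partial_prod (C_closed R r 3) = (fun n =>
    (prime_partial_prod (fun p => 1 - p%:R ^- (r + 2)) n)^-1 *
    (prime_partial_prod (fun p => 1 - p%:R ^- (2 * r + 3)) n)^-1 *
    prime_partial_prod F3 n).
  apply/funext => n; rewrite mulrC -invfM -big_split -prodf_div/=.
  by apply: eq_bigr => p /prime_gt1; exact: C_closed3.
apply: cvgM; last by apply: prime_prod_cvg_itv01; exact: F3_itv01.
have r2 : (1 < r + 2)%N by rewrite leq_addl.
have r3 : (1 < 2 * r + 3)%N by rewrite addnC.
apply: cvgM; rewrite -[X in _ --> X]invrK; apply: cvgV; try exact: euler_product.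
  by rewrite invr_neq0// gt_eqF// zeta_gt0.
by rewrite invr_neq0// gt_eqF// zeta_gt0.
Qed.

End limits.

(** Limits are unique, so any evaluation of the product of the [C_factor] evaluates the moment. *)
Lemma expectation_moment d (T : measurableType d) (R : realType)
    (P : probability T R) (k r : nat) (G : 'I_k -> nat -> {RV P >-> nat}) (l : R) :
  (0 < k)%N -> geometric_family G ->
  prime_partial_prod (C_factor R r k) @ \oo --> l ->
  'E_P[(fun w => Rk G w ^+ r)%R]%E = l%:E.
Proof.
move=> k0 geomG Cl; have [fE cE] := moment_cvg r k0 geomG.
by rewrite -(fineK fE); congr (_%:E); exact: cvg_unique cE Cl.
Qed.

Theorem corollary2p7 (R : realType) (r : nat) :
  [/\ (* the moment formula, for every k >= 1 *)
      forall (k : nat) (d : measure_display) (T : measurableType d)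
        (P : probability T R) (G : 'I_k -> nat -> {RV P >-> nat}),
        (0 < k)%N -> geometric_family G ->
        let F (p : nat) : R :=
          (1 - p%:R^-1) ^+ k / (1 - p%:R ^- (r + 1)) ^+ k *
          \sum_(1 <= j < k.+1)
            'C(k, j)%:R * (-1) ^+ (j - 1) *
            ((1 - p%:R ^- (j * (r + 1))) /
             (1 - p%:R ^- ((j - 1) * (r + 1) + 1))) in
        [/\ 'E_P[(fun w => Rk G w ^+ r)%R]%E =
              'E_P[(fun w => prime_prod (fun p => p%:R ^- (r * Zk G p w)))%R]%E,
            prime_prod_cvg F
          & 'E_P[(fun w => Rk G w ^+ r)%R]%E = (prime_prod F)%:E],
      (* k = 1 *)
      forall (d : measure_display) (T : measurableType d)
        (P : probability T R) (G : 'I_1 -> nat -> {RV P >-> nat}),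
        geometric_family G -> 'E_P[(fun w => Rk G w ^+ r)%R]%E = 1%:E,
      (* k = 2 *)
      [/\ C_well_defined R r 2,
          forall (d : measure_display) (T : measurableType d)
            (P : probability T R) (G : 'I_2 -> nat -> {RV P >-> nat}),
            geometric_family G ->
            (constC R r 2)%:E = 'E_P[(fun w => Rk G w ^+ r)%R]%E
        & constC R r 2 = zeta (r + 2)%:R / zeta 2]
    & (* k = 3 *)
      let F3 (p : nat) : R :=
        (1 - p%:R^-1) ^+ 2 *
        (1 + 2 / p%:R + 2 / p%:R ^+ (r + 2) + 1 / p%:R ^+ (r + 3)) in
      [/\ C_well_defined R r 3,
          forall (d : measure_display) (T : measurableType d)
            (P : probability T R) (G : 'I_3 -> nat -> {RV P >-> nat}),
            geometric_family G ->
            (constC R r 3)%:E = 'E_P[(fun w => Rk G w ^+ r)%R]%E,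
          prime_prod_cvg F3
        & constC R r 3 = zeta (r + 2)%:R * zeta (2 * r + 3)%:R * prime_prod F3]].
Proof.
split.
- move=> k d T P G k0 geomG F; split.
  + by congr expectation; apply/funext => w; exact: RkX.
  (* For general [k], convergence of the product is inherited from that of the expectations. *)
  + have [_ /cvgP] := moment_cvg r k0 geomG.
    by rewrite /prime_prod_cvg C_factor_partial_prod.
  + apply: expectation_moment => //; rewrite C_factor_partial_prod//.
    have [_ /cvgP] := moment_cvg r k0 geomG.
    by rewrite C_factor_partial_prod.
- move=> d T P G geomG; apply: expectation_moment => //.
  rewrite C_factor_partial_prod// (_ : prime_partial_prod _ = cst 1).
    exact: cvg_cst.
  by apply/funext => n; apply: big1 => p /prime_gt1; exact: C_closed1.
- have cC := @C_factor2_cvg R r.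
  (* The constant is evaluated from the limit [cC] alone, with no family [G]; the expectation is
     then matched through the same limit. *)
  have CE : constC R r 2 = zeta (r + 2)%:R / zeta 2 by apply: cvg_lim cC.
  split=> //; last first.
    by move=> d T P G geomG; rewrite CE (expectation_moment _ geomG cC).
  split; last exact: cvgP cC.
  by move=> p /prime_gt1; exact: summable_C_term.
- move=> F3; have cC := @C_factor3_cvg R r.
  have CE : constC R r 3 = zeta (r + 2)%:R * zeta (2 * r + 3)%:R * prime_prod F3.
    by apply: cvg_lim cC.
  split=> //; last by apply: prime_prod_cvg_itv01 => p; exact: F3_itv01.
  + split; last exact: cvgP cC.
    by move=> p /prime_gt1; exact: summable_C_term.
  + by move=> d T P G geomG; rewrite CE (expectation_moment _ geomG cC).
Qed.
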